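(* In the setting of the context (extended arm with inertial parameters in the interval vector $[\Delta]$, executed total feedback trajectories $q_A(t;k,\Delta)$, and their polynomial zonotope overapproximations), let $\{\mathbf{w}^j_j(\mathbf{q_A}(\mathbf{T_i};\mathbf{K}),[\Delta])\}_{j\in N_e}=\mathtt{PZRNEA}(\mathbf{q_A}(\mathbf{T_i};\mathbf{K}),[\Delta])$ for each $i\in N_t$. Then the vertical separation, linear slip and tip constraint functions are overapproximated by polynomial zonotopes computed from $\mathbf{w}^{n_q+1}_{n_q+1}(\mathbf{q_A}(\mathbf{T_i};\mathbf{K}),[\Delta])$; that is, for each $i\in N_t$ and each $k\in\mathbf{K}$, $$h_{sep}(w_o(q_A(t;k,\Delta)))\in\mathbf{h_{sep}}(\mathbf{w}^{n_q+1}_{n_q+1}(\mathbf{q_A}(\mathbf{T_i};k),[\Delta])),$$ $$h_{slip}(w_o(q_A(t;k,\Delta)))\in\mathbf{h_{slip}}(\mathbf{w}^{n_q+1}_{n_q+1}(\mathbf{q_A}(\mathbf{T_i};k),[\Delta])),$$ $$h_{tip}(w_o(q_A(t;k,\Delta)))\in\mathbf{h_{tip}}(\mathbf{w}^{n_q+1}_{n_q+1}(\mathbf{q_A}(\mathbf{T_i};k),[\Delta]))$$ for all $t\in\mathbf{T_i}$ and all $\Delta\in[\Delta]$.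
   Context: **Extended arm.** A serial manipulator has $n_q$ revolute joints; joint $j$ actuates link $j$; the last link rigidly holds a flat tray with unit normal $\hat n$ on which an object rests with circular contact area of radius $r$ and static friction coefficient $\mu_s$. The object is modeled as link $n_q+1$ attached by a fixed joint located at the projection of its center of mass on the contact plane, with frame $z$-axis $\hat n$. Let $N_e=\{1,\dots,n_q+1\}$; for the fixed joint, the joint coordinate and its derivatives are zero. The inertial parameters (masses $m_j$, centers of mass $p^j_{CoM,j}$, inertia tensors $I^j_j$, $j\in N_e$) form a vector $\Delta$ lying in a known bounded interval vector $[\Delta]$. Write $w_o=(f_o,n_o)\in\mathbb{R}^3\times\mathbb{R}^3$ for the contact wrench (force, moment) applied by the tray to the object, in the fixed-joint frame. Define $$h_{sep}(w_o)=-f_{o,z},\quad h_{slip}(w_o)=f_{o,x}^2+f_{o,y}^2-(\mu_sf_{o,z})^2,\quad h_{tip}(w_o)=\|\hat n\times n_o\|^2-r^2(\hat n\cdot f_o)^2 .$$ **Trajectories.** Let $T=[0,t_f]$. For $k\in K=[-1,1]^{n_q}$, $q_d(\cdot;k)$ is a desired trajectory and $q(t;k,\Delta)$ is the trajectory executed under a robust feedback controller with gain $K_r>0$ which guarantees $|q_{d,j}-q_j|\le\epsilon_p$ and $|\dot q_{d,j}-\dot q_j|\le\epsilon_v$ for all $t\in T$, $j\in N_e$, $\Delta\in[\Delta]$, for given constants $\epsilon_p,\epsilon_v>0$. Set $q_A=(q,\dot q,q_d,\dot q_d,\ddot q_d)$, $\dot q_a=\dot q_d+K_r(q_d-q)$,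 $\ddot q_a=\ddot q_d+K_r(\dot q_d-\dot q)$. **Contact wrench from the recursion (RNEA).** $w_o(q_A(t;k,\Delta))$ is identified with $w^{n_q+1}_{n_q+1}=(f^{n_q+1}_{n_q+1},n^{n_q+1}_{n_q+1})$ given, for parameters $\Delta$, by the following recursion. $R^{j}_{j-1}=(R^{j-1}_j(q_j))^\top$ and $p^{j-1}_j$ are the rotation and the (fixed) translation between frames $j-1$ and $j$, $z_j=(0,0,1)^\top$; start from $\omega_0=\omega_{a,0}=\dot\omega_0=0$, $a_0^0=(0,0,9.81)^\top$. For $j=1,\dots,n_q+1$: $\omega_j=R^j_{j-1}\omega_{j-1}+\dot q_jz_j$; $\omega_{a,j}=R^j_{j-1}\omega_{a,j-1}+\dot q_{a,j}z_j$; $\dot\omega_j=R^j_{j-1}\dot\omega_{j-1}+(R^j_{j-1}\omega_{a,j-1})\times(\dot q_jz_j)+\ddot q_{a,j}z_j$; $a_j=R^j_{j-1}\big(a_{j-1}+\dot\omega_{j-1}\times p^{j-1}_j+\omega_{j-1}\times(\omega_{a,j-1}\times p^{j-1}_j)\big)$; $a_{CoM,j}=a_j+\dot\omega_j\times p^j_{CoM,j}+\omega_j\times(\omega_{a,j}\times p^j_{CoM,j})$; $F_j=m_ja_{CoM,j}$; $N_j=I_j^j\dot\omega_j+\omega_{a,j}\times(I_j^j\omega_j)$. With $f_{n_q+2}=n_{n_q+2}=0$, for $j=n_q+1,\dots,1$: $f_j=R^j_{j+1}f_{j+1}+F_j$; $n_j=R^j_{j+1}n_{j+1}+p^j_{CoM,j}\times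 F_j+p^j_{j+1}\times(R^j_{j+1}f_{j+1})+N_j$; $w^j_j=(f_j,n_j)$. **Polynomial zonotopes.** A polynomial zonotope (bold symbols) is a set $\{\sum_i g_i x^{\alpha_i}: x\in[-1,1]^{n_g}\}$ with coefficients $g_i$ (vectors or matrices) and multi-exponents $\alpha_i\in\mathbb{N}^{n_g}$; $\mathtt{slice}(\mathbf P,x_j,\sigma)$ substitutes $x_j=\sigma\in[-1,1]$. Operations: $U\oplus V=\{u+v\}$, $UV=\{uv\}$, $U\otimes V=\{u\times v\}$ (all $u\in U,v\in V$). All polynomial zonotopes below may depend on the indeterminates $x_k=(x_{k_1},\dots,x_{k_{n_q}})$ representing $\mathbf K$ ($\mathbf{K_j}=x_{k_j}\in[-1,1]$), shared by all of them; $\mathbf P(\cdot;k)$ denotes $\mathtt{slice}$ at $x_k=k$, and operations commute with this slicing. $T$ is divided into $n_t=t_f/\Delta t\in\mathbb{N}$ subintervals $\mathbf{T_i}=[(i-1)\Delta t,i\Delta t]$, $N_t=\{1,\dots,n_t\}$. $\mathbf{q_{d,j}}(\mathbf{T_i};\mathbf K)$, $\mathbf{\dot q_{d,j}}(\mathbf{T_i};\mathbf K)$, $\mathbf{\ddot q_{d,j}}(\mathbf{T_i};\mathbf K)$ are polynomial zonotopes whose slices at $k$ contain $q_{d,j}(t;k),\dot q_{d,j}(t;k),\ddot q_{d,j}(t;k)$ for all $t\in\mathbf{T_i}$. Set $\mathbf{q_j}=\mathbf{q_{d,j}}\oplus[-\epsilon_p,\epsilon_p]$, $\mathbf{\dot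 q_j}=\mathbf{\dot q_{d,j}}\oplus[-\epsilon_v,\epsilon_v]$, $\mathbf{\dot q_{a,j}}=\mathbf{\dot q_{d,j}}\oplus K_r[-\epsilon_p,\epsilon_p]$, $\mathbf{\ddot q_{a,j}}=\mathbf{\ddot q_{d,j}}\oplus K_r[-\epsilon_v,\epsilon_v]$ (intervals regarded as polynomial zonotopes); $\mathbf{q_A}$ collects the polynomial zonotopes of the components of $q_A$. Rotation matrices are overapproximated (Taylor expansion) by polynomial zonotopes $\mathbf{R}^{j-1}_j$ whose slice at $k$ contains $R^{j-1}_j(\theta)$ for all $\theta\in\mathbf{q_j}(\mathbf{T_i};k)$. $\mathtt{PZRNEA}(\mathbf{q_A}(\mathbf{T_i};\mathbf K),[\Delta])$ runs the recursion above with every quantity replaced by its polynomial zonotope, inertial parameters by their intervals in $[\Delta]$, and $+,\cdot,\times$ by $\oplus$, set product, $\otimes$; its outputs are $\mathbf{w}^j_j(\mathbf{q_A}(\mathbf{T_i};\mathbf K),[\Delta])$, $j\in N_e$. $\mathbf{h_{sep}},\mathbf{h_{slip}},\mathbf{h_{tip}}$ are $h_{sep},h_{slip},h_{tip}$ evaluated with these set operations. *)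

(* Defs.v *)
From HB Require Import structures.
From mathcomp Require Import all_boot all_order all_algebra.
From mathcomp Require Import all_classical all_reals all_analysis.
Set Implicit Arguments.
Unset Strict Implicit.
Unset Printing Implicit Defensive.
Import Order.TTheory GRing.Theory Num.Theory.
Import numFieldNormedType.Exports.
Local Open Scope classical_set_scope.
Local Open Scope ring_scope.

Section Geometry.
Variable R : realType.

Definition ix : 'I_3 := @Ordinal 3 0 isT.
Definition iy : 'I_3 := @Ordinal 3 1 isT.
Definition iz : 'I_3 := @Ordinal 3 2 isT.

Definition vec3 (a b c : R) : 'cV[R]_3 := \col_i nth 0 [:: a; b; c] i.

Definition zvec : 'cV[R]_3 := vec3 0 0 1.

Definition cross (u v : 'cV[R]_3) : 'cV[R]_3 :=
  vec3 (u iy 0 * v iz 0 - u iz 0 * v iy 0)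
       (u iz 0 * v ix 0 - u ix 0 * v iz 0)
       (u ix 0 * v iy 0 - u iy 0 * v ix 0).

Definition dot (u v : 'cV[R]_3) : R := (u^T *m v) 0 0.

Definition enorm (u : 'cV[R]_3) : R := Num.sqrt (dot u u).

Definition is_rotation (A : 'M[R]_3) : Prop := A *m A^T = 1%:M /\ \det A = 1.

Definition Rz (theta : R) : 'M[R]_3 :=
  \matrix_(i, j) nth 0 (nth [::] [:: [:: cos theta; - sin theta; 0];
                                     [:: sin theta;   cos theta; 0];
                                     [:: 0; 0; 1]] i) j.

(* The derivative is taken relative to T, hence one-sided at its end points. *)
Definition has_derivative_on (T : set R) (f df : R -> R) : Prop :=
  forall t, T t ->
    (s - t)^-1 * (f s - f t) @[s --> within (T `\ t) (nbhs t)] --> df t.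

End Geometry.

Section PolynomialZonotopes.
Variables (R : realType) (nk : nat).

(* A polynomial zonotope with coefficients in V, in the indeterminates x_k
   (nk of them, shared by all polynomial zonotopes) and in finitely many private
   ones, indexed by pz_ind. *)
Record pz (V : lmodType R) : Type := PZ {
  pz_gen : finType;
  pz_ind : finType;
  pz_coef : pz_gen -> V;
  pz_expk : pz_gen -> 'I_nk -> nat;
  pz_exp : pz_gen -> pz_ind -> nat }.

Definition pz_eval (V : lmodType R) (P : pz V) (x : 'I_nk -> R)
    (y : pz_ind P -> R) : V :=
  \sum_(g : pz_gen P)
    (\prod_(j < nk) x j ^+ pz_expk g j * \prod_(l : pz_ind P) y l ^+ pz_exp g l)
    *: pz_coef g.

Definition pz_set (V : lmodType R) (P : pz V) : set V :=
  [set v | exists (x : 'I_nk -> R) (y : pz_ind P -> R),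
     [/\ forall j, x j \in `[-1, 1], forall l, y l \in `[-1, 1]
       & v = pz_eval x y]].

(* Substitutes x_k = k for all the shared indeterminates simultaneously. *)
Definition pz_slice (V : lmodType R) (P : pz V) (k : 'rV[R]_nk) : pz V :=
  PZ (fun g : pz_gen P => (\prod_(j < nk) k 0 j ^+ pz_expk g j) *: pz_coef g)
     (fun _ _ => 0%N) (@pz_exp V P).

Definition pz_const (V : lmodType R) (v : V) : pz V :=
  PZ (fun _ : unit => v) (fun _ _ => 0%N) (fun _ (l : void) => 0%N).

(* Meaningful only for linear f. *)
Definition pz_map (V W : lmodType R) (f : V -> W) (P : pz V) : pz W :=
  PZ (fun g => f (pz_coef g)) (@pz_expk V P) (@pz_exp V P).

(* In the two binary operations the private indeterminates of the operands are
   kept disjoint, so that on slices these are the set operations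
   {u + v} and {b u v} over all u, v independently: see pz_slice_add and
   pz_slice_bil. *)
Definition pz_add (V : lmodType R) (P Q : pz V) : pz V :=
  @PZ V (pz_gen P + pz_gen Q)%type (pz_ind P + pz_ind Q)%type
    (fun g => match g with inl a => pz_coef a | inr b => pz_coef b end)
    (fun g => match g with inl a => pz_expk a | inr b => pz_expk b end)
    (fun g l => match g, l with
                | inl a, inl l => pz_exp a l
                | inr b, inr l => pz_exp b l
                | _, _ => 0%N
                end).

(* Meaningful only for bilinear b. *)
Definition pz_bil (U V W : lmodType R) (b : U -> V -> W) (P : pz U) (Q : pz V) :
    pz W :=
  @PZ W (pz_gen P * pz_gen Q)%type (pz_ind P + pz_ind Q)%type
    (fun g => b (pz_coef g.1) (pz_coef g.2))
    (fun g j => (pz_expk g.1 j + pz_expk g.2 j)%N)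
    (fun g l => match l with
                | inl l => pz_exp g.1 l
                | inr l => pz_exp g.2 l
                end).

Lemma pz_set_sliceE (V : lmodType R) (P : pz V) (k : 'rV[R]_nk) v :
  pz_set (pz_slice P k) v <->
  exists2 y : pz_ind P -> R, forall l, y l \in `[-1, 1] & v = pz_eval (k 0) y.
Proof.
have E x (y : pz_ind P -> R) : pz_eval (P:=pz_slice P k) x y = pz_eval (k 0) y.
  rewrite /pz_eval /=; apply: eq_bigr => g _.
  rewrite [X in X * _](_ : _ = 1) ?mul1r; last by apply: big1.
  by rewrite scalerA mulrC.
split.
  by move=> [x [y [hx hy ->]]]; exists y => //; rewrite E.
by move=> [y hy ->]; exists (fun=> 0), y; split=> [j|//|]; rewrite ?in_itv /= ?lerN10 ?ler01 ?E.
Qed.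

Lemma pz_slice_add (V : lmodType R) (P Q : pz V) (k : 'rV[R]_nk) w :
  pz_set (pz_slice (pz_add P Q) k) w <->
  exists u v, [/\ pz_set (pz_slice P k) u, pz_set (pz_slice Q k) v & w = u + v].
Proof.
have E (y : pz_ind (pz_add P Q) -> R) :
  pz_eval (k 0) y =
    pz_eval (P:=P) (k 0) (y \o inl) + pz_eval (P:=Q) (k 0) (y \o inr).
  rewrite /pz_eval big_sumType /=; congr (_ + _); apply: eq_bigr => g _; congr (_ * _ *: _).
  rewrite big_sumType /= [X in _ * X]big1 ?mulr1 //.
  rewrite big_sumType /= [X in X * _]big1 ?mul1r //.
split.
  move/pz_set_sliceE=> [y hy ->]; rewrite E; eexists _, _; split; last reflexivity.
  - by apply/pz_set_sliceE; exists (y \o inl) => // l; apply: hy.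
  - by apply/pz_set_sliceE; exists (y \o inr) => // l; apply: hy.
move=> [u [v [/pz_set_sliceE [y hy ->] /pz_set_sliceE [z hz ->] ->]]].
apply/pz_set_sliceE; exists (fun l => match l with inl l => y l | inr l => z l end); first by case.
by rewrite E.
Qed.

Lemma pz_slice_bil (U V W : lmodType R) (b : U -> V -> W) (P : pz U)
    (Q : pz V) (k : 'rV[R]_nk) w :
  bilinear_for *:%R *:%R b ->
  pz_set (pz_slice (pz_bil b P Q) k) w <->
  exists u v, [/\ pz_set (pz_slice P k) u, pz_set (pz_slice Q k) v & w = b u v].
Proof.
move=> [bl br].
pose bL v : {linear U -> W} := HB.pack (b^~ v) (GRing.isLinear.Build R U W _ _ (bl v)).
pose bR u : {linear V -> W} := HB.pack (b u) (GRing.isLinear.Build R V W _ _ (br u)).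
have bLs v (I : finType) (F : I -> U) : b (\sum_i F i) v = \sum_i b (F i) v
  by exact: (linear_sum (bL v)).
have bRs u (I : finType) (F : I -> V) : b u (\sum_i F i) = \sum_i b u (F i)
  by exact: (linear_sum (bR u)).
have bLZ a u v : b (a *: u) v = a *: b u v
  by exact: (linearZ_LR (bL v)).
have bRZ a u v : b u (a *: v) = a *: b u v
  by exact: (linearZ_LR (bR u)).
have E (y : pz_ind (pz_bil b P Q) -> R) :
  pz_eval (k 0) y =
    b (pz_eval (P:=P) (k 0) (y \o inl))
      (pz_eval (P:=Q) (k 0) (y \o inr)).
  rewrite /pz_eval bLs -(pair_bigA _ (fun g h =>
   (\prod_(j < nk) k 0 j ^+ (pz_expk g j + pz_expk h j) *
   \prod_l y l ^+ match l with inl l0 => pz_exp g l0 | inr l0 => pz_exp h l0 end) *: b (pz_coef g) (pz_coef h))) /=.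
  apply: eq_bigr => g _.
  rewrite bRs; apply: eq_bigr => h _.
  rewrite bLZ bRZ scalerA; congr (_ *: _).
  rewrite big_sumType /= mulrACA; congr (_ * _).
  by rewrite -big_split /=; apply: eq_bigr => j _; rewrite exprD.
split.
  move/pz_set_sliceE=> [y hy ->]; rewrite E; eexists _, _; split; last reflexivity.
  - by apply/pz_set_sliceE; exists (y \o inl) => // l; apply: hy.
  - by apply/pz_set_sliceE; exists (y \o inr) => // l; apply: hy.
move=> [u [v [/pz_set_sliceE [y hy ->] /pz_set_sliceE [z hz ->] ->]]].
apply/pz_set_sliceE; exists (fun l => match l with inl l => y l | inr l => z l end); first by case.
by rewrite E.
Qed.

Definition pz_itv (lo hi : R) : pz R^o :=
  @PZ R^o bool unit (fun g => if g then (hi - lo) / 2 else (lo + hi) / 2)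
    (fun _ _ => 0%N) (fun g _ => nat_of_bool g).

(* Entrywise interval matrix: one private indeterminate per entry. *)
Definition pz_itv_mx (m n : nat) (lo hi : 'M[R]_(m, n)) : pz 'M[R]_(m, n) :=
  @PZ 'M[R]_(m, n) (option ('I_m * 'I_n)) ('I_m * 'I_n)%type
    (fun g => match g with
              | Some e => ((hi e.1 e.2 - lo e.1 e.2) / 2) *: delta_mx e.1 e.2
              | None => 2^-1 *: (lo + hi)
              end)
    (fun _ _ => 0%N)
    (fun g l => nat_of_bool (g == Some l)).

Definition pz_mul (P Q : pz R^o) : pz R^o :=
  pz_bil (fun a b : R^o => a * b : R^o) P Q.
Definition pz_opp (P : pz R^o) : pz R^o := pz_map (fun a : R^o => - a) P.
Definition pz_coord (i : 'I_3) (P : pz 'cV[R]_3) : pz R^o :=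
  pz_map (fun v : 'cV[R]_3 => v i 0 : R^o) P.
Definition pz_dot (P Q : pz 'cV[R]_3) : pz R^o :=
  pz_bil (fun u v => dot u v : R^o) P Q.
Definition pz_cross (P Q : pz 'cV[R]_3) : pz 'cV[R]_3 := pz_bil (@cross R) P Q.

End PolynomialZonotopes.

(* The recursion is written once over the operations below, and instantiated
   with the reals and with polynomial zonotopes. *)
Record rnea_ops (R : realType) : Type := RneaOps {
  Sc : Type;
  Vc : Type;
  Mx : Type;
  cstV : 'cV[R]_3 -> Vc;
  addV : Vc -> Vc -> Vc;
  scalV : Sc -> Vc -> Vc;
  crossV : Vc -> Vc -> Vc;
  mulMV : Mx -> Vc -> Vc;
  trM : Mx -> Mx }.

Definition real_ops (R : realType) : rnea_ops R := {|
  Sc := R; Vc := 'cV[R]_3; Mx := 'M[R]_3;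
  cstV := fun v => v;
  addV := fun u v => u + v;
  scalV := fun s v => s *: v;
  crossV := @cross R;
  mulMV := fun A v => A *m v;
  trM := fun A => A^T |}.

Definition pz_ops (R : realType) (nk : nat) : rnea_ops R := {|
  Sc := pz nk R^o; Vc := pz nk 'cV[R]_3; Mx := pz nk 'M[R]_3;
  cstV := @pz_const R nk _;
  addV := @pz_add R nk _;
  scalV := pz_bil (fun (s : R^o) (v : 'cV[R]_3) => (s : R) *: v);
  crossV := @pz_cross R nk;
  mulMV := pz_bil (fun (A : 'M[R]_3) (v : 'cV[R]_3) => A *m v);
  trM := pz_map (fun A : 'M[R]_3 => A^T) |}.

Section RNEA.
Variables (R : realType) (O : rnea_ops R) (n : nat).

Local Notation "u <+> v" := (addV u v) (at level 50, left associativity).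
Local Notation "u ><' v" := (crossV u v) (at level 40, left associativity).
Local Notation "A **' v" := (mulMV A v) (at level 40, left associativity).
Local Notation "s <*> v" := (scalV s v) (at level 40, left associativity).

(* For the j-th link: the rotation R^{j-1}_j, the translation p^{j-1}_j, m_j,
   p^j_{CoM,j}, I^j_j and the joint rates qdot_j, qdot_{a,j}, qddot_{a,j}. *)
Record link_data : Type := LinkData {
  l_rot : Mx O; l_trans : Vc O;
  l_mass : Sc O; l_com : Vc O; l_inertia : Mx O;
  l_dq : Sc O; l_dqa : Sc O; l_ddqa : Sc O }.

Record kinematics : Type := Kinematics {
  k_om : Vc O; k_oma : Vc O; k_dom : Vc O; k_acc : Vc O }.

Record wrench : Type := Wrench { w_f : Vc O; w_n : Vc O }.

Variable links : 'I_n.+1 -> link_data.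

(* Links are numbered 1, ..., n.+1 here. Link n.+2 is arbitrary: its rotation
   and translation only meet the zero wrench. *)
Definition link (j : nat) : link_data := links (inord j.-1).

Definition zO : Vc O := cstV O (zvec R).

Definition kin0 : kinematics :=
  Kinematics (cstV O 0) (cstV O 0) (cstV O 0)
             (cstV O (vec3 0 0 (981%:R / 100%:R))).

Definition kin_step (L : link_data) (K : kinematics) : kinematics :=
  let Rt := trM (l_rot L) in
  let p := l_trans L in
  Kinematics
    (Rt **' k_om K <+> l_dq L <*> zO)
    (Rt **' k_oma K <+> l_dqa L <*> zO)
    (Rt **' k_dom K <+> (Rt **' k_oma K) ><' (l_dq L <*> zO)
       <+> l_ddqa L <*> zO)
    (Rt **' (k_acc K <+> k_dom K ><' p <+> k_om K ><' (k_oma K ><' p))).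

Fixpoint rnea_kin (j : nat) : kinematics :=
  match j with
  | 0 => kin0
  | j'.+1 => kin_step (link j) (rnea_kin j')
  end.

Definition rnea_acom (j : nat) : Vc O :=
  let K := rnea_kin j in
  let c := l_com (link j) in
  k_acc K <+> k_dom K ><' c <+> k_om K ><' (k_oma K ><' c).

Definition rnea_F (j : nat) : Vc O := l_mass (link j) <*> rnea_acom j.

Definition rnea_N (j : nat) : Vc O :=
  let K := rnea_kin j in
  let I := l_inertia (link j) in
  I **' k_dom K <+> k_oma K ><' (I **' k_om K).

Definition wrench_step (j : nat) (W : wrench) : wrench :=
  let Rf := l_rot (link j.+1) **' w_f W in
  Wrench
    (Rf <+> rnea_F j)
    (l_rot (link j.+1) **' w_n W <+> l_com (link j) ><' rnea_F j
       <+> l_trans (link j.+1) ><' Rf <+> rnea_N j).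

(* rnea_back m is the wrench of index n.+2 - m. *)
Fixpoint rnea_back (m : nat) : wrench :=
  match m with
  | 0 => Wrench (cstV O 0) (cstV O 0)
  | m'.+1 => wrench_step (n.+1 - m') (rnea_back m')
  end.

(* The element j of 'I_n.+1 stands for the link number j.+1. *)
Definition rnea (j : 'I_n.+1) : wrench := rnea_back (n.+1 - j).

End RNEA.

Section Manipulator.
Variables (R : realType) (nq : nat).

(* Revolute joints 0, ..., nq.-1, and the fixed joint ord_max carrying the
   object. Joint j rotates about the z-axis of frame j, so that
   R^{j-1}_j(theta) = R^{j-1}_j(0) Rz(theta). *)
Record arm : Type := Arm {
  arm_rot0 : 'I_nq.+1 -> 'M[R]_3;
  arm_rot0_rotation : forall j, is_rotation (arm_rot0 j);
  arm_trans : 'I_nq.+1 -> 'cV[R]_3 }.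

Definition arm_rot (A : arm) (j : 'I_nq.+1) (theta : R) : 'M[R]_3 :=
  arm_rot0 A j *m Rz theta.

Record inertial : Type := Inertial {
  mass : 'I_nq.+1 -> R;
  com : 'I_nq.+1 -> 'cV[R]_3;
  inertia : 'I_nq.+1 -> 'M[R]_3 }.

(* An interval vector of inertial parameters is given by its lower and upper
   bounds. *)
Definition in_interval (lo hi D : inertial) : Prop :=
  forall j, [/\ lo.(mass) j <= D.(mass) j <= hi.(mass) j,
    forall a, lo.(com) j a 0 <= D.(com) j a 0 <= hi.(com) j a 0
    & forall a b,
        lo.(inertia) j a b <= D.(inertia) j a b <= hi.(inertia) j a b].

(* q_A = (q, qdot, q_d, qdot_d, qddot_d) *)
Record total_state (S : Type) : Type := TotalState {
  s_q : 'I_nq -> S; s_dq : 'I_nq -> S;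
  s_qd : 'I_nq -> S; s_dqd : 'I_nq -> S; s_ddqd : 'I_nq -> S }.

Definition extend (S : Type) (zero : S) (u : 'I_nq -> S) (j : 'I_nq.+1) : S :=
  if unlift ord_max j is Some i then u i else zero.

Definition dqa (Kr : R) (s : total_state R) (j : 'I_nq) : R :=
  s_dqd s j + Kr * (s_qd s j - s_q s j).
Definition ddqa (Kr : R) (s : total_state R) (j : 'I_nq) : R :=
  s_ddqd s j + Kr * (s_dqd s j - s_dq s j).

Definition contact_wrench (A : arm) (Kr : R) (s : total_state R)
    (D : inertial) : wrench (real_ops R) :=
  @rnea R (real_ops R) nq
    (fun j => @LinkData R (real_ops R)
       (arm_rot A j (extend 0 (s_q s) j)) (arm_trans A j)
       (mass D j) (com D j) (inertia D j)
       (extend 0 (s_dq s) j) (extend 0 (dqa Kr s) j) (extend 0 (ddqa Kr s) j))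
    ord_max.

Local Notation pzS := (pz nq (GRing.regular R)).
Local Notation pzV := (pz nq 'cV[R]_3).
Local Notation pzM := (pz nq 'M[R]_3).

Definition pz_zero : pzS := pz_const nq (0 : R^o).

Definition pz_total (eps_p eps_v : R) (qd dqd ddqd : 'I_nq -> pzS) :
    total_state pzS :=
  TotalState
    (fun j => pz_add (qd j) (pz_itv nq (- eps_p) eps_p))
    (fun j => pz_add (dqd j) (pz_itv nq (- eps_v) eps_v))
    qd dqd ddqd.

Definition pz_dqa (Kr eps_p : R) (s : total_state pzS) (j : 'I_nq) : pzS :=
  pz_add (s_dqd s j)
    (pz_mul (pz_const nq (Kr : R^o)) (pz_itv nq (- eps_p) eps_p)).
Definition pz_ddqa (Kr eps_v : R) (s : total_state pzS) (j : 'I_nq) : pzS :=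
  pz_add (s_ddqd s j)
    (pz_mul (pz_const nq (Kr : R^o)) (pz_itv nq (- eps_v) eps_v)).

(* rot is the family of overapproximations of the R^{j-1}_j over s_q s. *)
Definition pzrnea (A : arm) (Kr eps_p eps_v : R) (rot : 'I_nq.+1 -> pzM)
    (s : total_state pzS) (lo hi : inertial) :
    'I_nq.+1 -> wrench (pz_ops R nq) :=
  @rnea R (pz_ops R nq) nq
    (fun j => @LinkData R (pz_ops R nq)
       (rot j) (pz_const nq (arm_trans A j))
       (pz_itv nq (lo.(mass) j) (hi.(mass) j))
       (pz_itv_mx nq (lo.(com) j) (hi.(com) j))
       (pz_itv_mx nq (lo.(inertia) j) (hi.(inertia) j))
       (extend pz_zero (s_dq s) j)
       (extend pz_zero (pz_dqa Kr eps_p s) j)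
       (extend pz_zero (pz_ddqa Kr eps_v s) j)).

Definition slice_wrench (w : wrench (pz_ops R nq)) (k : 'rV[R]_nq) :
    wrench (pz_ops R nq) :=
  @Wrench R (pz_ops R nq) (pz_slice (w_f w : pzV) k) (pz_slice (w_n w : pzV) k).

(* Wrenches are expressed in the frame of the fixed joint, whose z-axis is the
   normal of the tray. *)
Definition nhat : 'cV[R]_3 := zvec R.

Section Constraints.
Variables (mu r : R).

Definition h_sep (w : wrench (real_ops R)) : R :=
  let f : 'cV[R]_3 := w_f w in - f iz 0.

Definition h_slip (w : wrench (real_ops R)) : R :=
  let f : 'cV[R]_3 := w_f w in
  f ix 0 ^+ 2 + f iy 0 ^+ 2 - (mu * f iz 0) ^+ 2.

Definition h_tip (w : wrench (real_ops R)) : R :=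
  let f : 'cV[R]_3 := w_f w in
  let n : 'cV[R]_3 := w_n w in
  enorm (cross nhat n) ^+ 2 - r ^+ 2 * dot nhat f ^+ 2.

Definition pz_sqr (P : pzS) : pzS := pz_mul P P.

Definition pz_h_sep (w : wrench (pz_ops R nq)) : pzS :=
  let f : pzV := w_f w in pz_opp (pz_coord iz f).

Definition pz_h_slip (w : wrench (pz_ops R nq)) : pzS :=
  let f : pzV := w_f w in
  pz_add (pz_add (pz_sqr (pz_coord ix f)) (pz_sqr (pz_coord iy f)))
    (pz_opp (pz_sqr (pz_mul (pz_const nq (mu : R^o)) (pz_coord iz f)))).

Definition pz_h_tip (w : wrench (pz_ops R nq)) : pzS :=
  let f : pzV := w_f w in
  let n : pzV := w_n w in
  let m := pz_cross (pz_const nq nhat) n in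
  pz_add (pz_dot m m)
    (pz_opp (pz_mul (pz_const nq (r ^+ 2 : R^o))
                    (pz_sqr (pz_dot (pz_const nq nhat) f)))).

End Constraints.

Definition param_box : set 'rV[R]_nq := [set k | forall j, k 0 j \in `[-1, 1]].

End Manipulator.

(* The i-th of the subintervals of length dt, counted from 0. *)
Definition subinterval (R : realType) (dt : R) (i : nat) : set R :=
  [set` `[i%:R * dt, i.+1%:R * dt]].

(* Main.v *)
(* Set operations on slices contain the pointwise operations, so, at a fixed
   k, membership is a logical relation between reals and polynomial zonotopes
   that every operation of the recursion preserves. Hence the actual contact
   wrench lies in the slice of the PZRNEA output as soon as the inputs of the
   recursion are enclosed, which for the executed trajectory is the tracking
   bound, and the constraint functions are built from the same operations. *)
Require Import Defs.
From HB Require Import structures.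
From mathcomp Require Import all_boot all_order all_algebra.
From mathcomp Require Import all_classical all_reals all_analysis.
From mathcomp Require Import ring lra.
Set Implicit Arguments.
Unset Strict Implicit.
Unset Printing Implicit Defensive.
Import Order.TTheory GRing.Theory Num.Theory.
Import numFieldNormedType.Exports.
Local Open Scope classical_set_scope.
Local Open Scope ring_scope.

(** * Bilinearity of the vector products, and coordinates in an interval *)

Lemma cross_bilinear (R : realType) : bilinear_for *:%R *:%R (@cross R).
Proof.
by split=> u a v w; apply/colP => i; rewrite !mxE;
  case: i => [[|[|[|[]]]] ?]; rewrite //= ?mxE; ring.
Qed.

Lemma dot_bilinear (R : realType) :
  bilinear_for *:%R *:%R (fun u v : 'cV[R]_3 => dot u v : R^o).
Proof.
split=> u a v w; rewrite /dot.
  by rewrite linearP /= mulmxDl -scalemxAl !mxE.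
by rewrite mulmxDr -scalemxAr !mxE.
Qed.

Lemma dot_ge0 (R : realType) (u : 'cV[R]_3) : 0 <= dot u u.
Proof. by rewrite /dot mxE sumr_ge0 // => i _; rewrite mxE -expr2 sqr_ge0. Qed.

(** [h_tip] is written with the norm, its polynomial zonotope version with [pz_dot]: squaring
    removes the root, which is not a polynomial operation. *)
Lemma enorm_sqr (R : realType) (u : 'cV[R]_3) : enorm u ^+ 2 = dot u u.
Proof. by rewrite /enorm sqr_sqrtr ?dot_ge0. Qed.

(* When lo = hi any y would do; division by 0 selects y = 0. *)
Lemma itv_paramE (R : realType) (lo hi v : R) : lo <= v <= hi ->
  exists2 y, y \in `[-1, 1] & v = (lo + hi) / 2 + y * ((hi - lo) / 2).
Proof.
move=> /andP[lov vhi]; exists ((2 * v - lo - hi) / (hi - lo)).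
  have [e|ne] := eqVneq (hi - lo) 0.
    by rewrite e invr0 mulr0 in_itv /= lerN10 ler01.
  have d0 : 0 < hi - lo by rewrite lt_neqAle eq_sym ne /=; lra.
  by rewrite in_itv /= ler_pdivlMr // ler_pdivrMr //; apply/andP; split; lra.
have [e|ne] := eqVneq (hi - lo) 0; first by rewrite e mul0r mulr0; lra.
by field.
Qed.

(** * Pointwise operations and slices *)

(** The point [k] of the box is an admissible value of the shared indeterminates. This leads from
    the lemmas on slices back to the plain [pz_set]. *)
Lemma pz_set_slice_sub (R : realType) (nk : nat) (V : lmodType R) (P : pz nk V)
    (k : 'rV[R]_nk) : param_box k -> pz_set (pz_slice P k) `<=` pz_set P.
Proof. by move=> hk v /pz_set_sliceE[y hy ->]; exists (k 0), y. Qed.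

Lemma pz_eval_slice (R : realType) (nk : nat) (V : lmodType R) (P : pz nk V)
    (k : 'rV[R]_nk) x (y : pz_ind P -> R) :
  pz_eval (P := pz_slice P k) x y = pz_eval (k 0) y.
Proof.
apply: eq_bigr => g _; rewrite /= [X in X * _]big1 //.
by rewrite mul1r scalerA mulrC.
Qed.

(** Slicing leaves no shared exponents, so a second slice changes nothing. Thus an already sliced
    wrench can be fed to lemmas about slices. *)
Lemma pz_slice_slice (R : realType) (nk : nat) (V : lmodType R) (P : pz nk V)
    (k : 'rV[R]_nk) :
  pz_set (pz_slice P k) `<=` pz_set (pz_slice (pz_slice P k) k).
Proof.
move=> v /pz_set_sliceE[y hy ->]; apply/pz_set_sliceE; exists y => //.
by rewrite pz_eval_slice.
Qed.

Lemma pz_slice_const (R : realType) (nk : nat) (V : lmodType R) (v : V)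
    (k : 'rV[R]_nk) : pz_set (pz_slice (pz_const nk v) k) v.
Proof.
apply/pz_set_sliceE; exists (fun=> 0) => [[]|].
rewrite /pz_eval /= (big_pred1 tt) => [|[]//].
by rewrite !big1 // ?mulr1 ?scale1r // => -[].
Qed.

(** A linear map passes through the sum of monomials, so the same private values serve as
    witness. *)
Lemma pz_slice_map (R : realType) (nk : nat) (V W : lmodType R)
    (f : {linear V -> W}) (P : pz nk V) (k : 'rV[R]_nk) v :
  pz_set (pz_slice P k) v -> pz_set (pz_slice (pz_map f P) k) (f v).
Proof.
move=> /pz_set_sliceE[y hy ->]; apply/pz_set_sliceE; exists y => //.
by rewrite /pz_eval linear_sum; apply: eq_bigr => g _; rewrite linearZ_LR.
Qed.

Lemma pz_slice_addW (R : realType) (nk : nat) (V : lmodType R) (P Q : pz nk V)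
    (k : 'rV[R]_nk) u v :
  pz_set (pz_slice P k) u -> pz_set (pz_slice Q k) v ->
  pz_set (pz_slice (pz_add P Q) k) (u + v).
Proof. by move=> Pu Qv; apply/pz_slice_add; exists u, v. Qed.

(** The half of [pz_slice_bil] that soundness uses; every product in the recursion and in the
    constraints is an instance. *)
Lemma pz_slice_bilW (R : realType) (nk : nat) (U V W : lmodType R)
    (b : U -> V -> W) (P : pz nk U) (Q : pz nk V) (k : 'rV[R]_nk) u v :
  bilinear_for *:%R *:%R b ->
  pz_set (pz_slice P k) u -> pz_set (pz_slice Q k) v ->
  pz_set (pz_slice (pz_bil b P Q) k) (b u v).
Proof. by move=> hb Pu Qv; apply/pz_slice_bil => //; exists u, v. Qed.

Lemma pz_slice_mul (R : realType) (nk : nat) (P Q : pz nk R^o)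
    (k : 'rV[R]_nk) (u v : R) :
  pz_set (pz_slice P k) u -> pz_set (pz_slice Q k) v ->
  pz_set (pz_slice (pz_mul P Q) k) (u * v).
Proof.
apply: (pz_slice_bilW (b := fun a b : R^o => a * b : R^o)).
by split=> u' a x y /=; rewrite ?mulrDl ?mulrDr /GRing.scale /= ?mulrA //
  (mulrC u').
Qed.

Lemma pz_slice_opp (R : realType) (nk : nat) (P : pz nk R^o)
    (k : 'rV[R]_nk) (u : R) :
  pz_set (pz_slice P k) u -> pz_set (pz_slice (pz_opp P) k) (- u).
Proof. exact: (pz_slice_map (-%R : {linear R^o -> R^o})). Qed.

Lemma pz_slice_coord (R : realType) (nk : nat) (i : 'I_3) (P : pz nk 'cV[R]_3)
    (k : 'rV[R]_nk) u :
  pz_set (pz_slice P k) u -> pz_set (pz_slice (pz_coord i P) k) (u i 0).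
Proof.
have lf : linear (fun v : 'cV[R]_3 => v i 0 : R^o).
  by move=> a v w; rewrite !mxE.
exact: (pz_slice_map (HB.pack (fun v : 'cV[R]_3 => v i 0 : R^o)
  (GRing.isLinear.Build R _ _ _ _ lf) : {linear _ -> _})).
Qed.

Lemma pz_slice_dot (R : realType) (nk : nat) (P Q : pz nk 'cV[R]_3)
    (k : 'rV[R]_nk) u v :
  pz_set (pz_slice P k) u -> pz_set (pz_slice Q k) v ->
  pz_set (pz_slice (pz_dot P Q) k) (dot u v).
Proof. exact: (pz_slice_bilW (@dot_bilinear R)). Qed.

Lemma pz_slice_itv (R : realType) (nk : nat) (lo hi v : R) (k : 'rV[R]_nk) :
  lo <= v <= hi -> pz_set (pz_slice (pz_itv nk lo hi) k) v.
Proof.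
move=> /itv_paramE[y hy ->]; apply/pz_set_sliceE; exists (fun=> y) => //.
rewrite /pz_eval big_bool /= !(big_pred1 tt) => [|[]//|[]//].
by rewrite !big1 // !mul1r expr0 expr1 scale1r addrC.
Qed.

Lemma pz_slice_itv_mx (R : realType) (nk m n : nat) (lo hi M : 'M[R]_(m, n))
    (k : 'rV[R]_nk) :
  (forall a b, lo a b <= M a b <= hi a b) ->
  pz_set (pz_slice (pz_itv_mx nk lo hi) k) M.
Proof.
move=> hM; have hy (e : 'I_m * 'I_n) := itv_paramE (hM e.1 e.2).
(* Entries have separate private indeterminates, so their interval coordinates can be chosen
   independently and gathered into one valuation. *)
have /choice[y {}hy] : forall e : 'I_m * 'I_n, exists y, y \in `[-1, 1] /\
    M e.1 e.2 = (lo e.1 e.2 + hi e.1 e.2) / 2 +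
                y * ((hi e.1 e.2 - lo e.1 e.2) / 2).
  by move=> e; have [y] := hy e; exists y.
apply/pz_set_sliceE; exists y => [e|]; first by have [] := hy e.
rewrite /pz_eval (bigD1 None) //= big1 // big1 // mulr1 scale1r.
(* The center [None] has been split off. In the monomial of [Some e] only the indeterminate of [e]
   has exponent 1. *)
rewrite (reindex_omap Some id) /=; last by case.
under eq_bigl do rewrite eqxx.
under eq_bigr => e _.
  rewrite mul1r (bigD1 e) //= eqxx expr1 big1 ?mulr1; last first.
    by move=> l ne; rewrite (inj_eq Some_inj) eq_sym (negbTE ne).
  over.
(* Both the target and the center are expanded in the matrix units, to compare coefficients entry by
   entry. *)
rewrite (matrix_sum_delta M) pair_bigA /=.
rewrite [2^-1 *: _]matrix_sum_delta pair_bigA -big_split /=.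
apply: eq_bigr => e _; rewrite scalerA -scalerDl; congr (_ *: _).
by have [_ ->] := hy e; rewrite !mxE (mulrC 2^-1).
Qed.

(** * The recursion preserves every relation compatible with its operations *)

(* Both instances are kept abstract: on concrete operations, unification would
   unfold the recursion down to explicit generators. *)
Record ops_rel (R : realType) (O O' : rnea_ops R) : Type := OpsRel {
  relS : Sc O -> Sc O' -> Prop;
  relV : Vc O -> Vc O' -> Prop;
  relM : Mx O -> Mx O' -> Prop;
  rel_cst : forall v, relV (cstV O v) (cstV O' v);
  rel_add : forall u u' v v',
    relV u u' -> relV v v' -> relV (addV u v) (addV u' v');
  rel_scal : forall s s' v v',
    relS s s' -> relV v v' -> relV (scalV s v) (scalV s' v');
  rel_cross : forall u u' v v',
    relV u u' -> relV v v' -> relV (crossV u v) (crossV u' v');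
  rel_mul : forall M M' v v',
    relM M M' -> relV v v' -> relV (mulMV M v) (mulMV M' v');
  rel_tr : forall M M', relM M M' -> relM (trM M) (trM M') }.

Definition rel_link (R : realType) (O O' : rnea_ops R) (S : ops_rel O O')
    (L : link_data O) (L' : link_data O') : Prop :=
  [/\ relM S (l_rot L) (l_rot L'), relV S (l_trans L) (l_trans L'),
      relS S (l_mass L) (l_mass L'), relV S (l_com L) (l_com L')
    & relM S (l_inertia L) (l_inertia L')] /\
  [/\ relS S (l_dq L) (l_dq L'), relS S (l_dqa L) (l_dqa L')
    & relS S (l_ddqa L) (l_ddqa L')].

Definition rel_kin (R : realType) (O O' : rnea_ops R) (S : ops_rel O O')
    (K : kinematics O) (K' : kinematics O') : Prop :=
  [/\ relV S (k_om K) (k_om K'), relV S (k_oma K) (k_oma K'),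
      relV S (k_dom K) (k_dom K') & relV S (k_acc K) (k_acc K')].

Definition rel_wrench (R : realType) (O O' : rnea_ops R) (S : ops_rel O O')
    (W : wrench O) (W' : wrench O') : Prop :=
  relV S (w_f W) (w_f W') /\ relV S (w_n W) (w_n W').

(** Each formula of the recursion is a term in the abstract operations, so relatedness follows its
    syntax down to the constants and the hypotheses. *)
Ltac relate := repeat first
  [ apply: rel_cst | apply: rel_add | apply: rel_scal | apply: rel_cross
  | apply: rel_mul | apply: rel_tr | assumption ].

Lemma rel_rnea_kin (R : realType) (O O' : rnea_ops R) (S : ops_rel O O')
    (n : nat) (L : 'I_n.+1 -> link_data O) (L' : 'I_n.+1 -> link_data O') :
  (forall j, rel_link S (L j) (L' j)) ->
  forall j, rel_kin S (rnea_kin L j) (rnea_kin L' j).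
Proof.
move=> hL; elim=> [|j [? ? ? ?]]; first by split; relate.
have [[? ? ? ? ?] [? ? ?]] := hL (inord j).
by split; rewrite /= /link /zO /=; relate.
Qed.

Lemma rel_rnea_F (R : realType) (O O' : rnea_ops R) (S : ops_rel O O')
    (n : nat) (L : 'I_n.+1 -> link_data O) (L' : 'I_n.+1 -> link_data O') :
  (forall j, rel_link S (L j) (L' j)) ->
  forall j, relV S (rnea_F L j) (rnea_F L' j).
Proof.
move=> hL j; have [? ? ? ?] := rel_rnea_kin hL j.
have [[? ? ? ? ?] _] := hL (inord j.-1).
by rewrite /rnea_F /rnea_acom /link; relate.
Qed.

Lemma rel_rnea_N (R : realType) (O O' : rnea_ops R) (S : ops_rel O O')
    (n : nat) (L : 'I_n.+1 -> link_data O) (L' : 'I_n.+1 -> link_data O') :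
  (forall j, rel_link S (L j) (L' j)) ->
  forall j, relV S (rnea_N L j) (rnea_N L' j).
Proof.
move=> hL j; have [? ? ? ?] := rel_rnea_kin hL j.
have [[? ? ? ? ?] _] := hL (inord j.-1).
by rewrite /rnea_N /link; relate.
Qed.

Lemma rel_rnea (R : realType) (O O' : rnea_ops R) (S : ops_rel O O')
    (n : nat) (L : 'I_n.+1 -> link_data O) (L' : 'I_n.+1 -> link_data O') :
  (forall j, rel_link S (L j) (L' j)) ->
  forall j, rel_wrench S (rnea L j) (rnea L' j).
Proof.
move=> hL j; rewrite /rnea; elim: (n.+1 - j)%N => [|m [? ?]] /=.
  by split; relate.
move: (rel_rnea_F hL (n.+1 - m)) (rel_rnea_N hL (n.+1 - m)).
(* The backward step at link number [n.+1 - m] reads that link and its successor, whose indices are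
   one lower. For [m = 0] the successor is out of range and [inord] returns [ord0], where [hL] still
   applies. *)
have [[? ? ? ? ?] _] := hL (inord (n.+1 - m).-1).
have [[? ? ? ? ?] _] := hL (inord (n.+1 - m)).
rewrite /wrench_step /link /=.
(* Forces and moments become atoms, which [relate] closes by assumption. *)
move: (rnea_F L _) (rnea_F L' _) (rnea_N L _) (rnea_N L' _) => ? ? ? ? ? ?.
by split; rewrite /=; relate.
Qed.

(** * Membership in a slice as a compatible relation *)

Lemma pz_slice_cross (R : realType) (nk : nat) (P Q : pz nk 'cV[R]_3)
    (k : 'rV[R]_nk) u v :
  pz_set (pz_slice P k) u -> pz_set (pz_slice Q k) v ->
  pz_set (pz_slice (pz_cross P Q) k) (cross u v).
Proof. exact: (pz_slice_bilW (@cross_bilinear R)). Qed.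

Lemma scale_bilinear (R : realType) :
  bilinear_for *:%R *:%R (fun (s : R^o) (v : 'cV[R]_3) => (s : R) *: v).
Proof.
split=> w a x y /=; first by rewrite scalerDl scalerA.
by rewrite scalerDr !scalerA mulrC.
Qed.

Lemma mulmx_bilinear (R : realType) :
  bilinear_for *:%R *:%R (fun (M : 'M[R]_3) (v : 'cV[R]_3) => M *m v).
Proof.
split=> w a x y /=; first by rewrite mulmxDl scalemxAl.
by rewrite mulmxDr scalemxAr.
Qed.

(** The parameter [k] is fixed because operands share [x_k]: values of [P] and [Q] taken at
    different parameters need not add up to a value of [pz_add P Q]. *)
Definition enclosure (R : realType) (nk : nat) (k : 'rV[R]_nk) :
    ops_rel (pz_ops R nk) (real_ops R) :=
  @OpsRel R (pz_ops R nk) (real_ops R)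
    (fun P => pz_set (pz_slice (P : pz nk R^o) k))
    (fun P => pz_set (pz_slice (P : pz nk 'cV[R]_3) k))
    (fun P => pz_set (pz_slice (P : pz nk 'M[R]_3) k))
    (fun v => pz_slice_const v k)
    (fun P u Q v => @pz_slice_addW R nk _ P Q k u v)
    (fun P s Q v =>
       @pz_slice_bilW R nk _ _ _ _ P Q k s v (@scale_bilinear R))
    (fun P u Q v => @pz_slice_cross R nk P Q k u v)
    (fun P M Q v =>
       @pz_slice_bilW R nk _ _ _ _ P Q k M v (@mulmx_bilinear R))
    (fun P M => @pz_slice_map R nk _ _ (@trmx R 3 3 : {linear _ -> _}) P k M).

(** * Enclosure of the constraint functions *)

(** The two factors have disjoint private indeterminates, so the slice holds all products of two
    values, in particular the diagonal ones. *)
Lemma pz_slice_sqr (R : realType) (nk : nat) (P : pz nk R^o)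
    (k : 'rV[R]_nk) (u : R) :
  pz_set (pz_slice P k) u -> pz_set (pz_slice (pz_sqr P) k) (u ^+ 2).
Proof. by move=> hu; rewrite expr2; apply: pz_slice_mul. Qed.

Lemma pz_slice_h_sep (R : realType) (nq : nat) (k : 'rV[R]_nq) P W :
  rel_wrench (enclosure k) P W -> pz_set (pz_slice (pz_h_sep P) k) (h_sep W).
Proof. by case=> hf _; apply/pz_slice_opp/pz_slice_coord. Qed.

Lemma pz_slice_h_slip (R : realType) (nq : nat) (mu : R) (k : 'rV[R]_nq) P W :
  rel_wrench (enclosure k) P W -> pz_set (pz_slice (pz_h_slip mu P) k) (h_slip mu W).
Proof.
case=> hf _; apply: pz_slice_addW.
  by apply: pz_slice_addW; apply/pz_slice_sqr/pz_slice_coord.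
apply/pz_slice_opp/pz_slice_sqr/pz_slice_mul; first exact: pz_slice_const.
exact: pz_slice_coord.
Qed.

Lemma pz_slice_h_tip (R : realType) (nq : nat) (r : R) (k : 'rV[R]_nq) P W :
  rel_wrench (enclosure k) P W -> pz_set (pz_slice (pz_h_tip r P) k) (h_tip r W).
Proof.
case=> hf hn; rewrite /h_tip enorm_sqr; apply: pz_slice_addW.
  have hm := pz_slice_cross (pz_slice_const (nhat R) k) hn.
  exact: pz_slice_dot.
apply/pz_slice_opp/pz_slice_mul; first exact: pz_slice_const.
by apply/pz_slice_sqr/pz_slice_dot => //; apply: pz_slice_const.
Qed.

(** * Enclosure of the executed trajectory, and conclusion *)

Lemma pz_slice_extend (R : realType) (nq : nat) (P : 'I_nq -> pz nq R^o)
    (u : 'I_nq -> R) (k : 'rV[R]_nq) :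
  (forall j, pz_set (pz_slice (P j) k) (u j)) ->
  forall j, pz_set (pz_slice (extend (pz_zero R nq) P j) k) (extend 0 u j).
Proof.
move=> hu j; rewrite /extend; case: unliftP => [i _|_]; first exact: hu.
(* Here the index is [ord_max], the fixed joint, with value 0. *)
exact: pz_slice_const.
Qed.

Lemma pz_slice_itv_sym (R : realType) (nk : nat) (e v : R) (k : 'rV[R]_nk) :
  `|v| <= e -> pz_set (pz_slice (pz_itv nk (- e) e) k) v.
Proof. by rewrite ler_norml => /pz_slice_itv; apply. Qed.

Lemma subinterval_sub (R : realType) (dt : R) (nt : nat) (i : 'I_nt) (t : R) :
  0 < dt -> subinterval dt i t -> t \in `[0, nt%:R * dt].
Proof.
move=> dt0; rewrite /subinterval /= !in_itv /= => /andP[it ti].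
apply/andP; split; first by apply: le_trans it; rewrite mulr_ge0 ?ler0n ?ltW.
by apply: le_trans ti _; rewrite ler_wpM2r ?(ltW dt0) // ler_nat.
Qed.

Theorem lemma8 (R : realType) (nq : nat)
  (A : arm R nq) (mu r : R) (hmu : 0 <= mu) (hr : 0 < r)
  (lo hi : inertial R nq)
  (Kr eps_p eps_v : R) (hKr : 0 < Kr) (hp : 0 < eps_p) (hv : 0 < eps_v)
  (tf dt : R) (nt : nat) (hdt : 0 < dt) (htf : tf = nt%:R * dt)
  (qd dqd ddqd : 'rV[R]_nq -> R -> 'I_nq -> R)
  (q dq : 'rV[R]_nq -> inertial R nq -> R -> 'I_nq -> R)
  (hdqd : forall k j, param_box k ->
     has_derivative_on [set` `[0, tf]] (fun t => qd k t j) (fun t => dqd k t j))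
  (hddqd : forall k j, param_box k ->
     has_derivative_on [set` `[0, tf]] (fun t => dqd k t j) (fun t => ddqd k t j))
  (hdq : forall k D j, param_box k -> in_interval lo hi D ->
     has_derivative_on [set` `[0, tf]] (fun t => q k D t j) (fun t => dq k D t j))
  (htrack : forall k D (t : R) j, param_box k -> in_interval lo hi D ->
     t \in `[0, tf] ->
     `|qd k t j - q k D t j| <= eps_p /\ `|dqd k t j - dq k D t j| <= eps_v)
  (Qd DQd DDQd : 'I_nt -> 'I_nq -> pz nq R^o)
  (hQd : forall (i : 'I_nt) k j (t : R), param_box k -> subinterval dt i t ->
     [/\ pz_set (pz_slice (Qd i j) k) (qd k t j),
         pz_set (pz_slice (DQd i j) k) (dqd k t j)
       & pz_set (pz_slice (DDQd i j) k) (ddqd k t j)])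
  (QA : 'I_nt -> total_state nq (pz nq R^o))
  (hQA : forall i, QA i = pz_total eps_p eps_v (Qd i) (DQd i) (DDQd i))
  (Rot : 'I_nt -> 'I_nq.+1 -> pz nq 'M[R]_3)
  (hRot : forall i k j (theta : R), param_box k ->
     pz_set (pz_slice (extend (pz_zero R nq) (s_q (QA i)) j) k) theta ->
     pz_set (pz_slice (Rot i j) k) (arm_rot A j theta)) :
  forall (i : 'I_nt) (k : 'rV[R]_nq), param_box k ->
  forall (t : R) (D : inertial R nq), subinterval dt i t -> in_interval lo hi D ->
  let qA := TotalState (q k D t) (dq k D t) (qd k t) (dqd k t) (ddqd k t) in
  let wo := contact_wrench A Kr qA D in
  let w := pzrnea A Kr eps_p eps_v (Rot i) (QA i) lo hi in
  let wk := slice_wrench (w ord_max) k in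
  [/\ pz_set (pz_h_sep wk) (h_sep wo),
      pz_set (pz_h_slip mu wk) (h_slip mu wo)
    & pz_set (pz_h_tip r wk) (h_tip r wo)].
Proof.
move=> i k hk t D ht hD qA wo w wk.
have tT : t \in `[0, tf] by rewrite htf; apply: subinterval_sub ht.
have trk j := htrack k D t j hk hD tT.
have hQ j := hQd i k j t hk ht.
have hq : forall j, pz_set (pz_slice (s_q (QA i) j) k) (q k D t j).
  move=> j; rewrite hQA /=; have [h _ _] := hQ j; have [hj _] := trk j.
  (* The executed position is the desired one plus the tracking error, which lies in the symmetric
     interval. *)
  rewrite -[q k D t j](subrKC (qd k t j)); apply: pz_slice_addW => //.
  by apply: pz_slice_itv_sym; rewrite distrC.
have hdQ : forall j, pz_set (pz_slice (s_dq (QA i) j) k) (dq k D t j).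
  move=> j; rewrite hQA /=; have [_ h _] := hQ j; have [_ hj] := trk j.
  rewrite -[dq k D t j](subrKC (dqd k t j)); apply: pz_slice_addW => //.
  by apply: pz_slice_itv_sym; rewrite distrC.
have hdqa j : pz_set (pz_slice (pz_dqa Kr eps_p (QA i) j) k) (dqa Kr qA j).
  have [_ h _] := hQ j; have [hj _] := trk j.
  (* The feedback term is the gain times the position error, which the tracking bound encloses
     directly. *)
  rewrite /pz_dqa hQA; apply: pz_slice_addW => //.
  by apply: pz_slice_mul; [apply: pz_slice_const | apply: pz_slice_itv_sym].
have hddqa j : pz_set (pz_slice (pz_ddqa Kr eps_v (QA i) j) k) (ddqa Kr qA j).
  have [_ _ h] := hQ j; have [_ hj] := trk j.
  rewrite /pz_ddqa hQA; apply: pz_slice_addW => //.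
  by apply: pz_slice_mul; [apply: pz_slice_const | apply: pz_slice_itv_sym].
have encl : rel_wrench (enclosure k) (w ord_max) wo.
  apply: rel_rnea => j; have [hm hc hI] := hD j; split; split=> /=.
  (* [hRot] turns an enclosed joint angle into an enclosed rotation; the object joint has angle
     0. *)
  - exact/hRot/pz_slice_extend.
  - exact: pz_slice_const.
  - exact: pz_slice_itv.
  (* The bounds on the center of mass are stated for column 0, the only one. *)
  - by apply: pz_slice_itv_mx => a b; rewrite ord1.
  - exact: pz_slice_itv_mx.
  - exact: pz_slice_extend.
  - exact: pz_slice_extend.
  - exact: pz_slice_extend.
(* The constraints take the sliced wrench as argument, hence the second slice. *)
have enclk : rel_wrench (enclosure k) wk wo.
  by case: encl => hf hn; split; apply: pz_slice_slice.
split; apply: (pz_set_slice_sub hk).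
- exact: pz_slice_h_sep.
- exact: pz_slice_h_slip.
- exact: pz_slice_h_tip.
Qed.
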